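(* Let $R$ be a semilocal ring. The following statements are equivalent: (1) $R$ is a left perfect ring. (2) $\{\mathscr{P}_\sigma\mid\sigma \text{ is a } t\text{-radical on } R\text{-Mod}\}=R\text{-conat}$.
   Context: $R$ is an associative ring with identity; modules are left $R$-modules. A preradical on $R\text{-Mod}$ is a functor $\sigma:R\text{-Mod}\to R\text{-Mod}$ with $\sigma(M)\le M$ for all $M$ and $f(\sigma(M))\le\sigma(N)$ for every homomorphism $f:M\to N$ ($\sigma(f)$ being the restriction of $f$). $\sigma$ is a $t$-radical if $\sigma(M)=\sigma(R)M$ for every module $M$. $\mathbb{T}_\sigma=\{M\mid\sigma(M)=M\}$. $\mathscr{P}_\sigma$ is the class of all modules $M$ having no nonzero quotient in $\mathbb{T}_\sigma$ (the zero module is included). For a class $\mathscr{D}$ of modules closed under quotients, $\mathscr{D}^{\perp_\twoheadrightarrow}$ is the class of all modules having no nonzero quotient in $\mathscr{D}$. $R\text{-conat}$ is the collection of conatural classes, i.e. classes of the form $\mathscr{D}^{\perp_\twoheadrightarrow}$ with $\mathscr{D}$ a class of modules closed under quotients. $R$ is left perfect if every left $R$-module has a projective cover; $R$ is semilocal if $R/J(R)$ is semisimple, where $J(R)$ is the Jacobson radical. *)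

(* Defs.v *)
From HB Require Import structures.
From mathcomp Require Import all_boot all_order all_algebra.
From mathcomp Require Import boolp.

Set Implicit Arguments.
Unset Strict Implicit.
Unset Printing Implicit Defensive.

Import GRing.Theory.
Local Open Scope ring_scope.

(* Submodules of M are elements of [submodClosed M].  They are boolean
   predicates; with classical logic ([asbool]) this is no restriction.
   Left ideals of R are submodules of the left regular module R^o.  A module Q
   is a quotient of M when there is a surjective linear map from M to Q, so
   that classes of modules closed under quotients are closed under
   isomorphism. *)

Section Submodules.
Variables (R : pzRingType) (M : lmodType R).
Implicit Types N K : submodClosed M.

Definition full_submod N : Prop := forall x : M, x \in N.

Definition direct_summand N : Prop :=
  exists K, (forall x : M, x \in N -> x \in K -> x = 0) /\
    (forall x : M, exists y z : M, [/\ y \in N, z \in K & x = y + z]).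

Definition maximal_submod N : Prop :=
  ~ full_submod N /\
  forall K, {subset N <= K} -> full_submod K \/ {subset K <= N}.

(* The submodule IM of finite sums of products a *: m with a in I. *)
Definition ideal_smul (I : submodClosed R^o) (x : M) : Prop :=
  exists n (a : 'I_n -> R) (m : 'I_n -> M),
    (forall i, a i \in I) /\ x = \sum_(i < n) a i *: m i.

End Submodules.

Definition semisimple (R : pzRingType) (M : lmodType R) : Prop :=
  forall N : submodClosed M, direct_summand N.

Definition surjective_lin (R : pzRingType) (M N : lmodType R)
  (f : {linear M -> N}) : Prop :=
  forall y : N, exists x : M, f x = y.

(* The quotient M / N: the quotient group of the library, with the induced
   scalar multiplication. *)
Section QuotientModule.
Variables (R : pzRingType) (M : lmodType R) (N : submodClosed M).

Definition submod_pred : {pred M} := N.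

Fact submod_pred_zmod_closed : zmod_closed submod_pred.
Proof. exact: GRing.submod_closedB (submodClosedP N). Qed.

HB.instance Definition _ :=
  GRing.isZmodClosed.Build M submod_pred submod_pred_zmod_closed.

Definition quot_module : Type := Quotient.quot submod_pred.

HB.instance Definition _ := GRing.Zmodule.on quot_module.

Definition quot_proj (x : M) : quot_module :=
  \pi_(Quotient.quot submod_pred)%qT x.

Definition quot_scale (a : R) (x : quot_module) : quot_module :=
  quot_proj (a *: repr (x : Quotient.quot submod_pred)).

Lemma quot_projK (x : quot_module) :
  quot_proj (repr (x : Quotient.quot submod_pred)) = x.
Proof. exact: reprK. Qed.

Lemma quot_projP (x y : M) : quot_proj x = quot_proj y <-> x - y \in N.
Proof.
rewrite -[x - y \in N]/(x - y \in submod_pred) Quotient.idealrBE.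
by split=> [/eqP|/eqP].
Qed.

Lemma quot_projD (x y : M) : quot_proj (x + y) = quot_proj x + quot_proj y.
Proof. by rewrite /quot_proj !piE. Qed.

Lemma quot_projZ a (x : M) : quot_proj (a *: x) = quot_scale a (quot_proj x).
Proof.
by apply/quot_projP; rewrite -scalerBr rpredZ //; apply/quot_projP/esym/quot_projK.
Qed.

Fact quot_scaleA a b x : quot_scale a (quot_scale b x) = quot_scale (a * b) x.
Proof. by rewrite -[x]quot_projK -!quot_projZ scalerA. Qed.

Fact quot_scale1 : left_id 1 quot_scale.
Proof. by move=> x; rewrite -[x]quot_projK -quot_projZ scale1r. Qed.

Fact quot_scaleDr : right_distributive quot_scale +%R.
Proof.
move=> a x y; rewrite -[x]quot_projK -[y]quot_projK.
by rewrite -quot_projD -!quot_projZ -quot_projD scalerDr.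
Qed.

Fact quot_scaleDl x : {morph quot_scale^~ x : a b / a + b}.
Proof.
by move=> a b; rewrite -[x]quot_projK -!quot_projZ -quot_projD scalerDl.
Qed.

HB.instance Definition _ := GRing.Zmodule_isLmodule.Build R quot_module
  quot_scaleA quot_scale1 quot_scaleDr quot_scaleDl.

End QuotientModule.

Section Rings.
Variable R : pzRingType.

(* J(R), the intersection of all maximal left ideals. *)
Definition jacobson : {pred R^o} := fun x : R^o =>
  `[< forall I : submodClosed R^o, maximal_submod I -> x \in I >].

Fact jacobson_submod_closed : GRing.submod_closed jacobson.
Proof.
split; first by apply/asboolP => I _; rewrite rpred0.
move=> a x y /asboolP Jx /asboolP Jy; apply/asboolP => I mI.
by rewrite rpredD ?rpredZ ?Jx ?Jy.
Qed.

HB.instance Definition _ :=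
  GRing.isSubmodClosed.Build R R^o jacobson jacobson_submod_closed.

Definition semilocal : Prop := semisimple (quot_module jacobson).

Definition projective (P : lmodType R) : Prop :=
  forall (A B : lmodType R) (g : {linear A -> B}) (h : {linear P -> B}),
    surjective_lin g -> exists k : {linear P -> A}, forall x, g (k x) = h x.

(* The kernel of f is superfluous in P. *)
Definition superfluous_kernel (P M : lmodType R) (f : {linear P -> M}) : Prop :=
  forall L : submodClosed P,
    (forall x : P, exists y z : P, [/\ f y = 0, z \in L & x = y + z]) ->
    full_submod L.

Definition has_projective_cover (M : lmodType R) : Prop :=
  exists (P : lmodType R) (f : {linear P -> M}),
    [/\ projective P, surjective_lin f & superfluous_kernel f].

Definition left_perfect : Prop := forall M : lmodType R, has_projective_cover M.

(* A plain function type: mathcomp's [set (lmodType R)] is ruled out by a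
   universe inconsistency. *)
Definition mod_class := lmodType R -> Prop.

Definition quotient_closed (D : mod_class) : Prop :=
  forall (M Q : lmodType R) (f : {linear M -> Q}),
    surjective_lin f -> D M -> D Q.

(* The modules having no nonzero quotient in D. *)
Definition quot_perp (D : mod_class) : mod_class := fun M =>
  forall (Q : lmodType R) (f : {linear M -> Q}),
    surjective_lin f -> D Q -> forall y : Q, y = 0.

(* R-conat. *)
Definition conatural_class (C : mod_class) : Prop :=
  exists2 D : mod_class, quotient_closed D & C = quot_perp D.

(* The action of a preradical on morphisms is by restriction, so it is
   determined by its values on modules and the functor laws are automatic. *)
Record preradical := Preradical {
  prerad :> forall M : lmodType R, submodClosed M;
  prerad_hom : forall (M N : lmodType R) (f : {linear M -> N}) (x : M),
    x \in prerad M -> f x \in prerad N }.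

Definition t_radical (s : preradical) : Prop :=
  forall (M : lmodType R) (x : M), x \in s M <-> ideal_smul (s R^o) x.

(* The class T_s. *)
Definition torsion_class (s : preradical) : mod_class := fun M =>
  full_submod (s M).

(* The class P_s. *)
Definition cotorsion_class (s : preradical) : mod_class :=
  quot_perp (torsion_class s).

(* The collection of the classes P_s, s a t-radical. *)
Definition t_radical_cotorsion_class (C : mod_class) : Prop :=
  exists2 s : preradical, t_radical s & C = cotorsion_class s.

End Rings.

Arguments jacobson R x : clear implicits.
Arguments conatural_class R C : clear implicits.
Arguments t_radical_cotorsion_class R C : clear implicits.

(* Main.v *)
Require Import Defs.
From HB Require Import structures.
From mathcomp Require Import all_boot all_order all_algebra.
From mathcomp Require Import boolp classical_sets functions.

Set Implicit Arguments.
Unset Strict Implicit.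
Unset Printing Implicit Defensive.

Import GRing.Theory.
Local Open Scope ring_scope.

(** Both conditions say the same thing about the radical [J] of [R]: a module
    [M] with [J M = M] is zero ([radical_nakayama], equivalent to the left
    T-nilpotency of [J]).

    If [R] is left perfect and [J M = M], the superfluous kernel of a
    projective cover [P] of [M] gives [J P = P]. A projective module with this
    property is zero: the coordinates of an element in a dual basis form a
    vector fixed by a matrix over [J], and such a vector vanishes
    ([projective_radical_eq0]).

    Conversely, let the property hold, let [R] be semilocal, and let [F] be a
    free module mapping onto [M], with [N] the inverse image of [J M]. As
    [F / J F] is semisimple, projectivity of [F] gives an endomorphism [a] of
    [F] that is, modulo [J F], the projection along [N / J F] onto a complement
    ([lift_complement]). Then [a (1 - a)] maps [F] into [J F], hence is
    locally nilpotent: the direct limit of its iterates is a module equal to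
    its radical, so zero ([radical_locally_nilpotent]). The Fitting
    decomposition of [F] under [a] and [1 - a] replaces the lifting of
    idempotents, and the part where [1 - a] is nilpotent is a projective cover
    of [M] ([nakayama_left_perfect]).

    For the second condition, note first that the classes [P_s] are always
    conatural. If every conatural class is of this form, so is the class of
    modules without nonzero quotient killed by [J], say with [I = s R]. The
    module [R / (I + J)] belongs to [P_s], since [I] kills all its quotients;
    but it is killed by [J], so it is zero and [I = R], as [J] is superfluous.
    Hence only the zero module lies in [P_s], while every [M] with [J M = M]
    does ([conatural_nakayama]). Conversely, suppose that [J M = M] forces
    [M = 0], and let [D] be closed under quotients. A nonzero module [M] has
    the nonzero semisimple quotient [M / J M], so that everything is decided by
    semisimple modules, and these are split by the ideal [I] that annihilates
    the semisimple modules without nonzero quotient in [D]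
    ([quot_perp_cotorsion]). *)

(** * Submodules cut out by propositions *)

Section SubmodOf.
Variables (R : pzRingType) (M : lmodType R).

Definition submod_axiom (P : M -> Prop) : Prop :=
  P 0 /\ forall a x y, P x -> P y -> P (a *: x + y).

(** A named head constant, on which the closure instance below is declared. *)
Definition prop_pred (P : M -> Prop) (hP : submod_axiom P) : {pred M} :=
  fun x => `[< P x >].

Fact prop_pred_closed P (hP : submod_axiom P) :
  GRing.submod_closed (prop_pred hP).
Proof.
split; first by apply/asboolP; case: hP.
by move=> a x y /asboolP Px /asboolP Py; apply/asboolP; case: hP => _; apply.
Qed.

HB.instance Definition _ P (hP : submod_axiom P) :=
  GRing.isSubmodClosed.Build R M (prop_pred hP) (prop_pred_closed hP).

Definition submod_of P (hP : submod_axiom P) : submodClosed M := prop_pred hP.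

Lemma submod_ofP P (hP : submod_axiom P) x : x \in submod_of hP <-> P x.
Proof. by split=> /asboolP. Qed.

Definition sub_module (N : submodClosed M) : Type :=
  {x : M | x \in submod_pred N}.
HB.instance Definition _ N := SubChoice.on (sub_module N).
HB.instance Definition _ N := [SubChoice_isSubLmodule of sub_module N by <:].

End SubmodOf.

(** * Maps, submodules and quotients *)

Section Basics.
Variable R : pzRingType.
Implicit Types M P Q : lmodType R.

(** A named head constant for a bare function with a proof of linearity. *)
Definition lin_fun M Q (f : M -> Q) (hf : linear f) : M -> Q := f.
HB.instance Definition _ M Q (f : M -> Q) (hf : linear f) :=
  GRing.isLinear.Build R M Q _ (lin_fun hf) hf.

Definition lin_of M Q (f : M -> Q) (hf : linear f) : {linear M -> Q} :=
  lin_fun hf.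

Definition sub_incl M (N : submodClosed M) : {linear sub_module N -> M} :=
  (val : sub_module N -> M).

Definition sub_elt M (N : submodClosed M) x (Nx : x \in N) : sub_module N :=
  exist _ x Nx.

Lemma sub_inclE M (N : submodClosed M) x (Nx : x \in N) :
  sub_incl N (sub_elt Nx) = x.
Proof. by []. Qed.

Lemma sub_incl_inj M (N : submodClosed M) : injective (sub_incl N).
Proof. exact: val_inj. Qed.

Lemma sub_inclP M (N : submodClosed M) (x : sub_module N) : sub_incl N x \in N.
Proof. exact: (valP x). Qed.

Fact corestrict_linear M Q (N : submodClosed Q) (f : {linear M -> Q})
  (fN : forall x, f x \in N) : linear (fun x => sub_elt (fN x)).
Proof.
by move=> a x y; apply: sub_incl_inj; rewrite [RHS]linearP; apply: linearP.
Qed.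

Definition corestrict M Q (N : submodClosed Q) (f : {linear M -> Q})
  (fN : forall x, f x \in N) : {linear M -> sub_module N} :=
  lin_of (corestrict_linear fN).

Fact quot_proj_linear M (N : submodClosed M) : linear (@quot_proj R M N).
Proof. by move=> a x y; rewrite quot_projD quot_projZ. Qed.

Definition quotp M (N : submodClosed M) : {linear M -> quot_module N} :=
  lin_of (@quot_proj_linear M N).

Lemma quotp_eq0 M (N : submodClosed M) x : quotp N x = 0 <-> x \in N.
Proof. by rewrite -(linear0 (quotp N)) quot_projP subr0. Qed.

Lemma quotp_surj M (N : submodClosed M) : surjective_lin (quotp N).
Proof. by move=> y; exists (repr y); apply: quot_projK. Qed.

Lemma factor_through M P Q (g : {linear M -> P}) (f : {linear M -> Q}) :
  surjective_lin g -> (forall x, g x = 0 -> f x = 0) ->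
  exists k : {linear P -> Q}, forall x, k (g x) = f x.
Proof.
move=> g_surj fg; have [r rE] := choice g_surj.
have fr x : f (r (g x)) = f x.
  by apply/subr0_eq; rewrite -linearB fg // linearB rE subrr.
have fr_lin : linear (f \o r).
  move=> a u v; have [x <-] := g_surj u; have [y <-] := g_surj v.
  by rewrite -linearP /= !fr linearP.
by exists (lin_of fr_lin).
Qed.

Fact lin_preim_axiom M Q (f : {linear M -> Q}) (N : submodClosed Q) :
  submod_axiom (fun x => f x \in N).
Proof.
split; first by rewrite linear0 rpred0.
by move=> a x y Nx Ny; rewrite linearP rpredD ?rpredZ.
Qed.
Definition lin_preim M Q (f : {linear M -> Q}) (N : submodClosed Q) :=
  submod_of (lin_preim_axiom f N).

Lemma lin_preimP M Q (f : {linear M -> Q}) (N : submodClosed Q) x :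
  x \in lin_preim f N <-> f x \in N.
Proof. exact: submod_ofP. Qed.

Fact lin_im_axiom M Q (f : {linear M -> Q}) (N : submodClosed M) :
  submod_axiom (fun y => exists2 x, x \in N & y = f x).
Proof.
split; first by exists 0; rewrite ?rpred0 ?linear0.
move=> a _ _ [x Nx ->] [y Ny ->]; exists (a *: x + y); last by rewrite linearP.
by rewrite rpredD ?rpredZ.
Qed.
Definition lin_im M Q (f : {linear M -> Q}) (N : submodClosed M) :=
  submod_of (lin_im_axiom f N).

Lemma lin_imP M Q (f : {linear M -> Q}) (N : submodClosed M) y :
  y \in lin_im f N <-> exists2 x, x \in N & y = f x.
Proof. exact: submod_ofP. Qed.

Lemma mem_lin_im M Q (f : {linear M -> Q}) (N : submodClosed M) x :
  x \in N -> f x \in lin_im f N.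
Proof. by move=> Nx; apply/lin_imP; exists x. Qed.

Fact sum_axiom M (N K : submodClosed M) :
  submod_axiom (fun x => exists y z, [/\ y \in N, z \in K & x = y + z]).
Proof.
split; first by exists 0, 0; rewrite !rpred0 addr0.
move=> a _ _ [y [z [Ny Kz ->]]] [y' [z' [Ny' Kz' ->]]].
exists (a *: y + y'), (a *: z + z'); split; rewrite ?rpredD ?rpredZ //.
by rewrite scalerDr addrACA.
Qed.
Definition submod_sum M (N K : submodClosed M) := submod_of (sum_axiom N K).

Lemma sumP M (N K : submodClosed M) x :
  x \in submod_sum N K <-> exists y z, [/\ y \in N, z \in K & x = y + z].
Proof. exact: submod_ofP. Qed.

Lemma submod_opp M (N : submodClosed M) x : x \in N -> - x \in N.
Proof. by move=> Nx; rewrite -scaleN1r rpredZ. Qed.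

Lemma submod_sub M (N : submodClosed M) x y :
  x \in N -> y \in N -> x - y \in N.
Proof. by move=> Nx Ny; rewrite rpredD ?submod_opp. Qed.

Lemma sub_suml M (N K : submodClosed M) : {subset N <= submod_sum N K}.
Proof. by move=> x Nx; apply/sumP; exists x, 0; rewrite rpred0 addr0. Qed.

Lemma sub_sumr M (N K : submodClosed M) : {subset K <= submod_sum N K}.
Proof. by move=> x Kx; apply/sumP; exists 0, x; rewrite rpred0 add0r. Qed.

Fact zero_axiom M : submod_axiom (fun x : M => x = 0).
Proof. by split=> // a x y -> ->; rewrite scaler0 addr0. Qed.
Definition zero_submod M := submod_of (zero_axiom M).

Lemma zeroP M (x : M) : x \in zero_submod M <-> x = 0.
Proof. exact: submod_ofP. Qed.

Fact scale_map_linear M (x : M) : linear (fun a : R^o => (a : R) *: x).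
Proof. by move=> a b c; rewrite scalerDl -scalerA. Qed.
Definition scale_map M (x : M) : {linear R^o -> M} :=
  lin_of (scale_map_linear x).

Fact full_axiom M : submod_axiom (fun x : M => True).
Proof. by []. Qed.
Definition whole M := submod_of (full_axiom M).
Lemma in_whole M x : x \in whole M.
Proof. exact/submod_ofP. Qed.

Definition cyclic M (x : M) : submodClosed M :=
  lin_im (scale_map x) (whole R^o).

Lemma cyclicP M (x y : M) : y \in cyclic x <-> exists a : R, y = a *: x.
Proof.
split=> [/lin_imP [a _ ->]|[a ->]]; first by exists a.
by apply/lin_imP; exists a; rewrite ?in_whole.
Qed.

Lemma in_cyclic M (x : M) a : a *: x \in cyclic x.
Proof. by apply/cyclicP; exists a. Qed.

Lemma mem_cyclic M (x : M) : x \in cyclic x.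
Proof. by rewrite -[X in X \in _]scale1r in_cyclic. Qed.

(** The shape of Zorn's lemma from which come both maximal left ideals, where
    [T] is [{1}], and complements of a submodule, where [T] consists of its
    nonzero elements. *)
Lemma zorn_submod M (N : submodClosed M) (T : M -> Prop) :
  (forall x, x \in N -> ~ T x) ->
  exists K : submodClosed M,
    [/\ {subset N <= K}, forall x, x \in K -> ~ T x &
        forall K' : submodClosed M, {subset K <= K'} ->
          (forall x, x \in K' -> ~ T x) -> {subset K' <= K}].
Proof.
move=> NT.
pose good (K : submodClosed M) :=
  {subset N <= K} /\ forall x, x \in K -> ~ T x.
pose C := {K : submodClosed M | good K}.
pose le (K L : C) := `[< {subset sval K <= sval L} >].
have goodN : good N by split.
pose N' : C := exist _ N goodN.
have := @ZL_preorder C N' le; case.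
- by move=> K; apply/asboolP.
- by move=> L K K' /asboolP KL /asboolP LK'; apply/asboolP => x /KL /LK'.
- move=> A A_tot.
  (* An empty chain is bounded by [N]; otherwise the union is a submodule. *)
  have [[K0 AK0]|A0] := pselect (exists K, A K); last first.
    by exists N' => K AK; case: A0; exists K.
  have U_ax : submod_axiom (fun x => exists2 K, A K & x \in sval K).
    split; first by exists K0; rewrite ?rpred0.
    move=> a x y [K AK Kx] [L AL Ly].
    have [/asboolP KL|/asboolP LK] := A_tot _ _ AK AL.
      by exists L => //; rewrite rpredD ?rpredZ // KL.
    by exists K => //; rewrite rpredD ?rpredZ // LK.
  have goodU : good (submod_of U_ax).
    split=> [x Nx|x /submod_ofP [K AK Kx]].
      by apply/submod_ofP; exists K0 => //; apply: (svalP K0).1.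
    exact: (svalP K).2 Kx.
  exists (exist _ _ goodU) => K AK; apply/asboolP => x Kx.
  by apply/submod_ofP; exists K.
move=> K Kmax; exists (sval K); have [NK KT] := svalP K; split=> // K' KK' K'T.
have gK' : good K' by split=> // x /NK /KK'.
by have /asboolP := Kmax (exist _ K' gK') (asboolT KK').
Qed.

End Basics.

(** * The submodules I M *)

Section IdealSmul.
Variable R : pzRingType.
Implicit Types (I : submodClosed R^o) (M Q : lmodType R).

Lemma ideal_smul_scale I M (a : R) (m : M) : a \in I -> ideal_smul I (a *: m).
Proof.
by move=> Ia; exists 1, (fun=> a), (fun=> m); split=> //; rewrite big_ord1.
Qed.

Fact ideal_smul_axiom I M : submod_axiom (@ideal_smul R M I).
Proof.
split.
  by exists 0, (fun=> 0), (fun=> 0); rewrite big_ord0; split=> // -[].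
move=> r _ _ [n [a [m [Ia ->]]]] [n' [a' [m' [Ia' ->]]]].
exists (n + n')%N,
  (fun i => match fintype.split i with inl j => r * a j | inr j => a' j end),
  (fun i => match fintype.split i with inl j => m j | inr j => m' j end).
split=> [i|].
  by case: (fintype.split i) => j //; apply: (@rpredZ R R^o I r (a j) (Ia j)).
rewrite big_split_ord scaler_sumr; congr (_ + _); apply: eq_bigr => i _ /=.
  by rewrite (unsplitK (inl i)) scalerA.
by rewrite (unsplitK (inr i)).
Qed.

Definition smul I M : submodClosed M := submod_of (@ideal_smul_axiom I M).

Lemma smulP I M (x : M) : x \in smul I M <-> ideal_smul I x.
Proof. exact: submod_ofP. Qed.

Lemma mem_smul I M (a : R) (m : M) : a \in I -> a *: m \in smul I M.
Proof. by move=> Ia; apply/smulP/ideal_smul_scale. Qed.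

Lemma smul_sub I M (N : submodClosed M) :
  (forall (a : R) m, a \in I -> a *: m \in N) -> {subset smul I M <= N}.
Proof.
by move=> IN _ /smulP [n [a [m [Ia ->]]]]; apply: rpred_sum => i _; apply: IN.
Qed.

Lemma smul_lin I M Q (f : {linear M -> Q}) x :
  x \in smul I M -> f x \in smul I Q.
Proof.
have /(_ x) : {subset smul I M <= lin_preim f (smul I Q)}.
  by apply: smul_sub => a m Ia; apply/lin_preimP; rewrite linearZ mem_smul.
by move=> h /h /lin_preimP.
Qed.

Lemma smul_lift I M Q (f : {linear M -> Q}) y : surjective_lin f ->
  y \in smul I Q -> exists2 x, x \in smul I M & f x = y.
Proof.
move=> f_surj; have /(_ y) : {subset smul I Q <= lin_im f (smul I M)}.
  apply: smul_sub => a m Ia; have [x <-] := f_surj m.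
  by rewrite -linearZ; apply: mem_lin_im; apply: mem_smul.
by move=> h /h /lin_imP [x Ix ->]; exists x.
Qed.

Lemma smul_quot_eq0 I M x :
  x \in smul I (quot_module (smul I M)) -> x = 0.
Proof.
pose X := quot_module (smul I M).
have Z : {subset smul I X <= zero_submod X}.
  apply: smul_sub => a m Ia; apply/zeroP; have [y <-] := quotp_surj m.
  by rewrite -linearZ; apply/quotp_eq0; apply: mem_smul.
by move/Z/zeroP.
Qed.

End IdealSmul.

(** * The Jacobson radical *)

Section Jacobson.
Variable R : pzRingType.
Implicit Types (x y r u : R) (I : submodClosed R^o).

Lemma full_ideal I : (1 : R) \in I -> full_submod I.
Proof. by move=> I1 x; rewrite -[x]mulr1; apply: (@rpredZ R R^o I x 1 I1). Qed.

Lemma jacobsonP x :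
  x \in jacobson R <-> forall I, maximal_submod I -> x \in I.
Proof. by split=> [/asboolP|] // h; apply/asboolP. Qed.

Lemma exists_maximal I : (1 : R) \notin I ->
  exists2 K : submodClosed R^o, maximal_submod K & {subset I <= K}.
Proof.
move=> I1; have [x Ix|K [IK K1 Kmax]] := @zorn_submod R R^o I (fun x => x = 1).
  by move=> x1; move: I1; rewrite -x1 Ix.
exists K => //; split=> [Kfull|L KL]; first exact: K1 (Kfull 1) (erefl 1).
have [L1|L1] := boolP ((1 : R) \in L); [left|right]; first exact: full_ideal.
by apply: Kmax => // x Lx x1; move: L1; rewrite -x1 Lx.
Qed.

Lemma jacobson_left_inv x : x \in jacobson R -> exists u, u * (1 - x) = 1.
Proof.
move=> Jx; apply: contrapT => no_u.
pose I := cyclic (1 - x : R^o).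
have I1 : (1 : R) \notin I.
  by apply/negP => /cyclicP [u uE]; apply: no_u; exists u.
have [K Kmax IK] := exists_maximal I1.
apply: Kmax.1; apply: full_ideal.
have -> : (1 : R) = (1 - x : R^o) + (x : R^o) by rewrite subrK.
apply: (@rpredD R^o K); first by rewrite IK ?mem_cyclic.
by move/jacobsonP: Jx; apply.
Qed.

Lemma jacobson_mull r x : x \in jacobson R -> r * x \in jacobson R.
Proof. exact: (@rpredZ R R^o (jacobson R) r x). Qed.

(** A left inverse [u] of [1 - x] is [1 + u x], so it has a left inverse as
    well, which can only be [1 - x]. *)
Lemma jacobson_right_inv x : x \in jacobson R -> exists u, (1 - x) * u = 1.
Proof.
move=> Jx; have [u uE] := jacobson_left_inv Jx; exists u.
have JNux : - (u * x) \in jacobson R by rewrite (@rpredN R^o) jacobson_mull.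
have [v] := jacobson_left_inv JNux.
have -> : 1 - - (u * x) = u by rewrite opprK -[X in X + _]uE mulrBr mulr1 subrK.
move=> vu; have -> // : 1 - x = v.
by rewrite -[LHS]mul1r -{1}vu -mulrA uE mulr1.
Qed.

(** A maximal left ideal [K] and a scalar [r] outside it give the maximal left
    ideal of all [z] with [z * r] in [K], the annihilator of the class of [r] in
    the simple module [R / K]. *)
Lemma jacobson_mulr x r : x \in jacobson R -> x * r \in jacobson R.
Proof.
move=> Jx; apply/jacobsonP => K Kmax.
have [Kr|Kr] := boolP (r \in K); first exact: (@rpredZ R R^o K x r Kr).
pose A := lin_preim (scale_map (r : R^o)) K.
have AE z : z \in A <-> z * r \in K by apply: lin_preimP.
apply/AE; move/jacobsonP: Jx; apply; split=> [/(_ 1)/AE|L AL].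
  by rewrite mul1r (negPf Kr).
have [LA|/existsNP [k /not_implyP [Lk kA]]] := pselect ({subset L <= A}).
  by right.
left; have kr : ~ k * r \in K by move/AE.
have [|full|sub] := Kmax.2 (submod_sum K (cyclic (k * r : R^o))).
- exact: sub_suml.
- have /sumP [m [_ [Km /cyclicP [s ->] rE]]] := full r.
  have As : 1 - s * k \in A.
    apply/AE; suff -> : (1 - s * k) * r = m by [].
    by rewrite mulrBl mul1r -mulrA [X in X - _]rE; apply: (@addrK R).
  apply: full_ideal.
  have -> : (1 : R) = (1 - s * k : R^o) + (s *: (k : R^o)) by rewrite subrK.
  by apply: (@rpredD R^o L); [apply: AL | apply: (@rpredZ R R^o)].
- by case: kr; apply: sub; apply: sub_sumr; apply: mem_cyclic.
Qed.

End Jacobson.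

(** * Modules killed by the Jacobson radical *)

Section Semisimple.
Variable R : pzRingType.
Implicit Types M Q X : lmodType R.

Definition jacobson_kills X : Prop :=
  forall (a : R) (x : X), a \in jacobson R -> a *: x = 0.

Lemma semisimple_quotient M Q (f : {linear M -> Q}) :
  surjective_lin f -> semisimple M -> semisimple Q.
Proof.
move=> f_surj ssM N; have [K [NK0 NKtop]] := ssM (lin_preim f N).
exists (lin_im f K); split=> [y Ny /lin_imP [x Kx yE]|x].
  by rewrite yE (NK0 x) ?linear0 //; apply/lin_preimP; rewrite -yE.
have [m <-] := f_surj x; have [y [z [/lin_preimP Ny Kz ->]]] := NKtop m.
by exists (f y), (f z); rewrite linearD mem_lin_im.
Qed.

Lemma jacobson_kills_quotient X Q (f : {linear X -> Q}) :
  surjective_lin f -> jacobson_kills X -> jacobson_kills Q.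
Proof.
move=> f_surj JX a q Ja; have [x <-] := f_surj q.
by rewrite -linearZ JX ?linear0.
Qed.

Lemma jacobson_kills_quot_smul M :
  jacobson_kills (quot_module (smul (jacobson R) M)).
Proof. by move=> a x Ja; apply: smul_quot_eq0; apply: mem_smul. Qed.

Lemma cyclic_semisimple X (x : X) :
  semilocal R -> jacobson_kills X -> semisimple (sub_module (cyclic x)).
Proof.
move=> slR JX.
pose f := corestrict (N := cyclic x) (f := scale_map x) (in_cyclic x).
have [a /quotp_eq0 Ja|g gE] :=
  factor_through (f := f) (quotp_surj (N := jacobson R)).
  by apply: sub_incl_inj; rewrite linear0; apply: JX.
apply: (@semisimple_quotient _ _ g _ slR).
move=> y; have /cyclicP [a yE] := sub_inclP y.
by exists (quotp (jacobson R) a); rewrite gE; apply: sub_incl_inj; rewrite yE.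
Qed.

(** A complement of [N] is a submodule [K] maximal among those meeting [N]
    trivially: for [x] outside [N + K], a complement of [(N + K) :&: R x] in the
    semisimple module [R x] could be added to [K]. *)
Lemma jacobson_kills_semisimple X :
  semilocal R -> jacobson_kills X -> semisimple X.
Proof.
move=> slR JX N.
have [x /zeroP -> []//|K [_ NK Kmax]] :=
  @zorn_submod R X (zero_submod X) (fun x => x \in N /\ x <> 0).
have NK0 x : x \in N -> x \in K -> x = 0.
  by move=> Nx Kx; apply: contrapT => x0; apply: (NK x).
exists K; split=> // x.
apply/sumP.
pose C := cyclic x.
have [L [NKL0 NKLtop]] := cyclic_semisimple (x := x) slR JX
  (lin_preim (sub_incl C) (submod_sum N K)).
have [y [z [/lin_preimP NKy Lz xE]]] := NKLtop (sub_elt (mem_cyclic x)).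
have {}xE : x = sub_incl C y + sub_incl C z by rewrite -linearD -xE.
rewrite xE rpredD //; apply: sub_sumr.
(* [K + L] still meets [N] trivially, so [L] lies in [K] by maximality. *)
apply: (Kmax (submod_sum K (lin_im (sub_incl C) L))) => [||].
- exact: sub_suml.
- move=> _ /sumP [k [_ [Kk /lin_imP [l Ll ->] ->]]] [Nkl]; apply.
  have l0 : l = 0.
    apply: NKL0 => //; apply/lin_preimP/sumP.
    exists (k + sub_incl C l), (- k); split=> //; first exact: submod_opp.
    by rewrite addrC addrA addNr add0r.
  by apply: NK0 => //; rewrite l0 linear0 addr0.
by apply: sub_sumr; apply: mem_lin_im.
Qed.

End Semisimple.

(** * The Nakayama property *)

Section Nakayama.
Variable R : pzRingType.

(** The module form of the left T-nilpotency of the Jacobson radical; Nakayama's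
    lemma gives it for finitely generated [M] over any ring. *)
Definition radical_nakayama : Prop :=
  forall M : lmodType R, full_submod (smul (jacobson R) M) ->
  forall x : M, x = 0.

(** The property applied to the quotient by [L], which equals its radical. *)
Lemma radical_superfluous (M : lmodType R) (L : submodClosed M) :
  radical_nakayama ->
  full_submod (submod_sum (smul (jacobson R) M) L) -> full_submod L.
Proof.
move=> TN top x; apply/quotp_eq0; apply: TN => q.
have [m <-] := quotp_surj q; have /sumP [y [z [Jy Lz ->]]] := top m.
by rewrite linearD ((quotp_eq0 _ z).2 Lz) addr0 smul_lin.
Qed.

End Nakayama.

(** * Free and projective modules *)

Section Free.
Variables (R : pzRingType) (T : choiceType).

Definition covers (s : seq T) (f : T -> R) : Prop :=
  forall t, t \notin s -> f t = 0.

Fact finsupp_axiom :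
  @submod_axiom R (T -> R^o) (fun f => exists s, covers s f).
Proof.
split; first by exists [::].
move=> a f g [s sf] [s' s'g]; exists (s ++ s') => t; rewrite mem_cat negb_or.
move=> /andP [/sf ft0 /s'g gt0].
by rewrite -[LHS]/(a * f t + g t) ft0 gt0 mulr0 addr0.
Qed.

Definition free_module : lmodType R := sub_module (submod_of finsupp_axiom).

Fact coord_linear (t : T) : linear (fun f : free_module => sub_incl _ f t).
Proof. by move=> a f g; rewrite linearP. Qed.

Definition coord (t : T) : {linear free_module -> R^o} :=
  lin_of (coord_linear t).

Lemma coord_inj (f g : free_module) :
  (forall t, coord t f = coord t g) -> f = g.
Proof. by move=> fg; apply: val_inj; apply: funext. Qed.

Lemma coord_finsupp (f : free_module) :
  exists2 s, uniq s & covers s (coord^~ f).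
Proof.
have /submod_ofP [s sf] := sub_inclP f.
exists (undup s); first exact: undup_uniq.
by move=> t; rewrite mem_undup => /sf.
Qed.

Fact basis_finsupp (t : T) :
  (fun x => (x == t)%:R : R^o) \in submod_of finsupp_axiom.
Proof.
by apply/submod_ofP; exists [:: t] => x; rewrite inE => /negPf ->.
Qed.

Definition basis_elt (t : T) : free_module := sub_elt (basis_finsupp t).

Lemma coord_basis x t : coord x (basis_elt t) = (x == t)%:R.
Proof. by []. Qed.

(** A linear combination does not depend on the finite list of indices used to
    write it, which makes the extension below linear. *)
Lemma sum_covers (V : lmodType R) (g : T -> V) (f : T -> R) (s s' : seq T) :
  uniq s -> uniq s' -> covers s f -> covers s' f ->
  \sum_(t <- s) f t *: g t = \sum_(t <- s') f t *: g t.
Proof.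
move=> us us' sf s'f.
have supp r : \sum_(t <- r) f t *: g t = \sum_(t <- r | f t != 0) f t *: g t.
  rewrite (bigID (fun t => f t != 0)) /= [X in _ + X]big1 ?addr0 // => t.
  by rewrite negbK => /eqP ->; rewrite scale0r.
rewrite 2!supp -big_filter -[RHS]big_filter; apply: perm_big.
apply: uniq_perm; rewrite ?filter_uniq // => t; rewrite !mem_filter.
have [//|ft0] := eqVneq (f t) 0; rewrite /=.
have in_supp r : covers r f -> t \in r.
  by move=> rf; apply: contraNT ft0 => /rf ->.
by rewrite !in_supp.
Qed.

Lemma free_extend (V : lmodType R) (g : T -> V) :
  exists h : {linear free_module -> V}, forall f s,
    uniq s -> covers s (coord^~ f) ->
    h f = \sum_(t <- s) (coord t f : R) *: g t.
Proof.
pose supp f := s2val (cid2 (coord_finsupp f)).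
have supp_uniq f : uniq (supp f) by rewrite /supp; case: cid2.
have supp_covers f : covers (supp f) (coord^~ f) by rewrite /supp; case: cid2.
pose h f := \sum_(t <- supp f) (coord t f : R) *: g t.
have hE f s : uniq s -> covers s (coord^~ f) ->
    h f = \sum_(t <- s) (coord t f : R) *: g t.
  by move=> us sf; apply: sum_covers.
suff h_lin : linear h by exists (lin_of h_lin).
move=> a f f'; pose s := undup (supp f ++ supp f').
have s_covers (e : free_module) : covers (supp f ++ supp f') (coord^~ e) ->
    covers s (coord^~ e).
  by move=> se t; rewrite mem_undup => /se.
have sf : covers s (coord^~ f).
  by apply: s_covers => t; rewrite mem_cat negb_or => /andP [/supp_covers].
have sf' : covers s (coord^~ f').
  by apply: s_covers => t; rewrite mem_cat negb_or => /andP [_ /supp_covers].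
have sD : covers s (coord^~ (a *: f + f')).
  by move=> t ts; rewrite linearP sf ?sf' // scaler0 addr0.
rewrite !(hE _ s) ?undup_uniq // scaler_sumr -big_split.
by apply: eq_bigr => t _ /=; rewrite linearP scalerDl scalerA.
Qed.

Lemma free_expansion f s : uniq s -> covers s (coord^~ f) ->
  f = \sum_(t <- s) (coord t f : R) *: basis_elt t.
Proof.
move=> us sf; apply: coord_inj => x; rewrite linear_sum.
under eq_bigr => t _ do rewrite linearZ /= coord_basis.
have [xs|xs] := boolP (x \in s); last first.
  rewrite sf // big1_seq // => t /andP [_ ts].
  by case: eqP xs => [->|_ _]; [rewrite ts|rewrite scaler0].
rewrite (bigD1_seq x) //= eqxx big1 ?addr0; first by rewrite [RHS]mulr1.
by move=> t /negPf; rewrite eq_sym => ->; rewrite scaler0.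
Qed.

Lemma free_projective : projective free_module.
Proof.
move=> A B g h g_surj.
have [a aE] := choice (fun t => g_surj (h (basis_elt t))).
have [k kE] := free_extend a; exists k => f.
have [s us sf] := coord_finsupp f.
rewrite (kE f s) // linear_sum {2}(free_expansion us sf) linear_sum.
by apply: eq_bigr => t _; rewrite !linearZ /= aE.
Qed.

End Free.

Arguments coord {R T} t.
Arguments basis_elt {R T} t.

Section Projective.
Variable R : pzRingType.
Implicit Types M P : lmodType R.

Lemma free_cover M : exists2 h : {linear free_module R M -> M},
  surjective_lin h & forall f s, uniq s -> covers s (coord^~ f) ->
    h f = \sum_(m <- s) (coord m f : R) *: m.
Proof.
have [h hE] := free_extend (fun m : M => m); exists h => // m.
exists (basis_elt m); rewrite (hE _ [:: m]) // ?big_seq1 ?coord_basis ?eqxx.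
  exact: scale1r.
by move=> x; rewrite inE coord_basis => /negPf ->.
Qed.

(** The functionals are the coordinates of a section of the free cover of [P];
    the dual basis is indexed by all elements of [P]. *)
Lemma dual_basis P : projective P ->
  exists phi : P -> {linear P -> R^o}, forall x, exists s : seq P,
    x = \sum_(p <- s) (phi p x : R) *: p.
Proof.
move=> projP; have [h h_surj hE] := free_cover P.
have [k kE] := projP _ _ h idfun h_surj.
exists (fun p => coord p \o k : {linear P -> R^o}) => x.
have [s us sf] := coord_finsupp (k x); exists s.
by rewrite -[LHS](kE x) (hE _ s).
Qed.

Lemma complement_projection M (N K : submodClosed M) :
  (forall x, x \in N -> x \in K -> x = 0) -> full_submod (submod_sum N K) ->
  exists p : {linear M -> sub_module N},
    (forall x, p (sub_incl N x) = x) /\ forall x, x - sub_incl N (p x) \in K.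
Proof.
move=> NK0 top.
have dec x : exists y : sub_module N, x - sub_incl N y \in K.
  have /sumP [y [z [Ny Kz ->]]] := top x; exists (sub_elt Ny).
  by rewrite sub_inclE addrC addKr.
have [p pP] := choice dec.
have pE x y : x - sub_incl N y \in K -> p x = y.
  move=> Ky; apply: sub_incl_inj; apply: subr0_eq; apply: NK0.
    by rewrite -linearB; apply: sub_inclP.
  suff -> : sub_incl N (p x) - sub_incl N y =
     (x - sub_incl N y) - (x - sub_incl N (p x)) by apply: submod_sub.
  by rewrite opprB [RHS]addrC addrA subrK.
have p_lin : linear p.
  move=> a x y; apply: pE; rewrite (linearP (sub_incl N)).
  rewrite opprD addrACA -scalerBr.
  by rewrite rpredD ?rpredZ.
by exists (lin_of p_lin); split=> // x; apply: pE; rewrite subrr rpred0.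
Qed.

Lemma projective_retract P M (i : {linear M -> P}) (p : {linear P -> M}) :
  (forall x, p (i x) = x) -> projective P -> projective M.
Proof.
move=> ipK projP A B g h g_surj.
have [k kE] := projP A B g (h \o p : {linear P -> B}) g_surj.
by exists (k \o i : {linear M -> A}) => x /=; rewrite kE /= ipK.
Qed.

(** Lifting the projection [P -> P / N] along its restriction to [K], which is
    still surjective; [N] and [K] may intersect. *)
Lemma project_along P (N K : submodClosed P) :
  projective P -> full_submod (submod_sum N K) ->
  exists a : {linear P -> P}, forall x, a x \in K /\ x - a x \in N.
Proof.
move=> projP top.
have [q|k kE] := projP _ _ (quotp N \o sub_incl K : {linear _ -> _}) (quotp N).
  have [x <-] := quotp_surj q; have /sumP [y [z [Ny Kz ->]]] := top x.
  by exists (sub_elt Kz) => /=; rewrite linearD ((quotp_eq0 N y).2 Ny) add0r.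
exists (sub_incl K \o k : {linear P -> P}) => x; split; first exact: sub_inclP.
apply/quotp_eq0; rewrite linearB.
by rewrite -[X in _ - X]/((quotp N \o sub_incl K) (k x)) kE subrr.
Qed.

End Projective.

(** * A projective module equal to its radical is zero *)

Section Bass.
Variable R : pzRingType.

(** Nakayama's lemma for the right ideal generated by the [r i], by elimination:
    [1 - a n n] is invertible, so that the last equation expresses [r n] by the
    others and the remaining system again has entries in the radical. *)
Lemma radical_matrix_fixed n (r : nat -> R) (a : nat -> nat -> R) :
  (forall i j, a i j \in jacobson R) ->
  (forall j, (j < n)%N -> r j = \sum_(i < n) r i * a i j) ->
  forall j, (j < n)%N -> r j = 0.
Proof.
elim: n a => [//|n IHn] a Ja rE.
have [u uE] := jacobson_right_inv (Ja n n).
have rnE : r n = \sum_(i < n) r i * (a i n * u).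
  rewrite -[LHS]mulr1 -uE mulrA mulrBr mulr1 {1}rE // big_ord_recr /= addrK.
  by rewrite mulr_suml; apply: eq_bigr => i _; rewrite mulrA.
have r0 j : (j < n)%N -> r j = 0.
  move: j; apply: (IHn (fun i j => a i j + a i n * u * a n j)) => [i j|j ltjn].
    apply: (@rpredD R^o (jacobson R)) => //.
    by do 2!apply: jacobson_mulr.
  rewrite {1}rE ?(leq_trans ltjn) // big_ord_recr /= [in X in _ + X]rnE.
  rewrite mulr_suml -big_split.
  by apply: eq_bigr => i _ /=; rewrite mulrDr !mulrA.
move=> j; rewrite ltnS leq_eqVlt => /predU1P [->|/r0 //].
by rewrite rnE big1 // => i _; rewrite r0 ?mul0r.
Qed.

(** Write [x] as a combination of [m 0], [m 1], ... with coefficients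
    [phi (m i) x].  Applying the [phi (m j)] shows that these coefficients are
    fixed by the matrix [phi (m j) (m i)], whose entries lie in [J] because
    [phi (m j)] maps [J P = P] into [J R]. *)
Lemma projective_radical_eq0 (P : lmodType R) : projective P ->
  full_submod (smul (jacobson R) P) -> forall x : P, x = 0.
Proof.
move=> projP JP x; have [phi phiE] := dual_basis projP; have [s sE] := phiE x.
pose m i := nth 0 s i.
have xE : x = \sum_(i < size s) (phi (m i) x : R) *: m i.
  by rewrite {1}sE (big_nth 0) big_mkord.
have phiJ p q : (phi p q : R) \in jacobson R.
  have /smulP [n [a [y [Ja ->]]]] := smul_lin (phi p) (JP q).
  apply: (@rpred_sum R^o (jacobson R)) => i _.
  by apply: jacobson_mulr.
rewrite xE big1 // => i _.
rewrite (@radical_matrix_fixed (size s) (fun i => phi (m i) x)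
  (fun i j => phi (m j) (m i))) ?scale0r // => j _.
by rewrite {1}xE linear_sum; apply: eq_bigr => k _; rewrite linearZ.
Qed.

Lemma left_perfect_nakayama : left_perfect R -> radical_nakayama R.
Proof.
move=> perfR M JM m; have [P [f [projP f_surj f_small]]] := perfR M.
have JP : full_submod (smul (jacobson R) P).
  apply: f_small => x.
  have [y Jy yE] := smul_lift f_surj (JM (f x)).
  by exists (x - y), y; rewrite linearB yE subrr subrK.
by have [x <-] := f_surj m; rewrite (projective_radical_eq0 projP JP x) linear0.
Qed.

End Bass.

(** * Local nilpotency *)

Section Iterate.
Variables (R : pzRingType) (M : lmodType R).
Implicit Types f : {linear M -> M}.

Fact iter_linear f n : linear (iter n f).
Proof. by move=> c x y; elim: n => //= n ->; rewrite linearP. Qed.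

Lemma iter_lin0 f n : iter n f 0 = 0.
Proof. exact: (linear0 (lin_of (iter_linear f n))). Qed.

Fact nil_part_axiom f : submod_axiom (fun x => exists n, iter n f x = 0).
Proof.
split; first by exists 0%N.
move=> c x y [m mx] [n ny]; exists (m + n)%N; rewrite iter_linear.
rewrite {1}addnC !iterD mx ny.
by rewrite !iter_lin0 scaler0 addr0.
Qed.

Definition nil_part f : submodClosed M := submod_of (nil_part_axiom f).

Lemma nil_partP f x : x \in nil_part f <-> exists n, iter n f x = 0.
Proof. exact: submod_ofP. Qed.

End Iterate.

(** The direct limit of [F -> F -> ...] along [b] is realised as the module [U]
    of the sequences that are eventually orbits of [b], modulo its submodule [Z]
    of the sequences that are eventually zero. *)
Section LocalNilpotency.
Variables (R : pzRingType) (F : lmodType R) (b : {linear F -> F}).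

Fact eventual_orbit_axiom : @submod_axiom R (nat -> F)
  (fun u => exists N, forall n, (N <= n)%N -> u n.+1 = b (u n)).
Proof.
split; first by exists 0%N => n _; rewrite [RHS]linear0.
move=> c u v [N uN] [N' vN']; exists (maxn N N') => n.
rewrite geq_max => /andP [/uN un /vN' vn].
by rewrite -[LHS]/(c *: u n.+1 + v n.+1) un vn -linearP.
Qed.

Let U := submod_of eventual_orbit_axiom.

Fact eventually_zero_axiom : @submod_axiom R (nat -> F)
  (fun u => exists N, forall n, (N <= n)%N -> u n = 0).
Proof.
split; first by exists 0%N.
move=> c u v [N uN] [N' vN']; exists (maxn N N') => n.
rewrite geq_max => /andP [/uN un /vN' vn].
by rewrite -[LHS]/(c *: u n + v n) un vn scaler0 addr0.
Qed.

Let Z := lin_preim (sub_incl U) (submod_of eventually_zero_axiom).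

Fact shifted_orbit_linear N :
  linear (fun x : F => (fun n => iter (n - N) b x)).
Proof. by move=> c x y; apply: funext => n; rewrite iter_linear. Qed.

Fact shifted_orbit_eventual N x : lin_of (shifted_orbit_linear N) x \in U.
Proof.
apply/submod_ofP; exists N => n leNn.
by rewrite -[LHS]/(iter (n.+1 - N) b x) subSn.
Qed.

(** This induces the map to the limit from the copy of [F] at position [N]; the
    terms before [N] are arbitrary. *)
Definition shifted_orbit N : {linear F -> sub_module U} :=
  corestrict (shifted_orbit_eventual N).

(** An element of the limit given by [y] at position [N] is given by [b y] at
    position [N + 1], where it lies in the image of [J F].  So the limit equals
    its radical and vanishes, which for the orbit of [x] means that some iterate
    of [b] kills [x]. *)
Lemma radical_locally_nilpotent : radical_nakayama R ->
  (forall x, b x \in smul (jacobson R) F) -> full_submod (nil_part b).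
Proof.
move=> TN bJ x.
have Zfull : full_submod Z.
  apply: radical_superfluous => // u; have /submod_ofP [N uN] := sub_inclP u.
  pose v := shifted_orbit N.+1 (b (sub_incl U u N)).
  apply/sumP; exists v, (u - v).
  split; [exact: smul_lin| |by rewrite addrC subrK].
  apply/lin_preimP/submod_ofP; exists N.+1 => n leNn; rewrite linearB.
  rewrite -[LHS]/(sub_incl U u n - iter (n - N.+1) b (b (sub_incl U u N))).
  have uE k : sub_incl U u (k + N.+1)%N = iter k b (b (sub_incl U u N)).
    elim: k => [|k IHk]; first by rewrite add0n uN.
    by rewrite addSn uN ?IHk // addnS leqW ?leq_addl.
  by rewrite -{1}(subnK leNn) uE subrr.
have /lin_preimP/submod_ofP [N xN] := Zfull (shifted_orbit 0 x).
apply/nil_partP; exists N; have := xN N (leqnn N).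
by rewrite -[LHS]/(iter (N - 0) b x) subn0.
Qed.

End LocalNilpotency.

(** * Fitting decomposition *)

Section Fitting.
Variables (R : pzRingType) (F : lmodType R) (a c : {linear F -> F}).
Hypothesis ac1 : forall x, a x + c x = x.

Lemma complementary_comm x : a (c x) = c (a x).
Proof.
have cE y : c y = y - a y by apply: (addrI (a y)); rewrite ac1 addrC subrK.
by rewrite !cE linearB.
Qed.

Lemma iter_complementary_comm n x : iter n a (c x) = c (iter n a x).
Proof. by elim: n => //= n ->; rewrite complementary_comm. Qed.

Lemma complementary_iter_comm n x : iter n c (a x) = a (iter n c x).
Proof. by elim: n => //= n ->; rewrite complementary_comm. Qed.

Lemma iter_comp_comm n x : iter n (a \o c) x = iter n a (iter n c x).
Proof.
by elim: n => //= n ->; rewrite iter_complementary_comm.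
Qed.

(** As [x = a x + c x], induction on the exponents: [a x] needs one power of [a]
    less than [x], and [c x] one power of [c] less. *)
Lemma fitting_cap x : x \in nil_part a -> x \in nil_part c -> x = 0.
Proof.
move=> /nil_partP [m mx] /nil_partP [n nx].
move: {2}(m + n)%N (leqnn (m + n)) => k.
elim: k m n x mx nx => [|k IHk] [|m] [|n] x //.
rewrite addSn ltnS => mx nx lemn.
have ax0 : a x = 0.
  apply: (IHk m n.+1) => //; first by rewrite -iterSr.
  by rewrite complementary_iter_comm nx linear0.
have cx0 : c x = 0.
  apply: (IHk m.+1 n); last by rewrite addSnnS.
    by rewrite iter_complementary_comm mx linear0.
  by rewrite -iterSr.
by rewrite -[x]ac1 ax0 cx0 addr0.
Qed.

Lemma fitting_sum m n x : iter m a (iter n c x) = 0 ->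
  x \in submod_sum (nil_part a) (nil_part c).
Proof.
move: {2}(m + n)%N (leqnn (m + n)) => k.
elim: k m n x => [|k IHk] [|m] [|n] x //.
- by move=> _ x0; apply: sub_suml; apply/nil_partP; exists 0%N.
- by move=> _ x0; apply: sub_suml; apply/nil_partP; exists 0%N.
- by move=> _ x0; apply: sub_sumr; apply/nil_partP; exists n.+1.
- by move=> _ x0; apply: sub_suml; apply/nil_partP; exists m.+1.
rewrite addSn ltnS => lemn x0; rewrite -[x]ac1 rpredD //.
  apply: (IHk m n.+1) => //.
  by rewrite complementary_iter_comm -iterSr.
apply: (IHk m.+1 n); first by rewrite addSnnS.
by rewrite -iterSr.
Qed.

End Fitting.

(** * Projective covers *)

Section Covers.
Variable R : pzRingType.

(** Let [K] be the inverse image in [F] of a complement of the image of [N] in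
    the semisimple module [F / J F].  The intersection of [N] and [K] lies in
    [J F], and a map into [K] that is the identity modulo [N] sends [N] into
    that intersection. *)
Lemma lift_complement (F : lmodType R) (N : submodClosed F) :
  semilocal R -> projective F ->
  exists a : {linear F -> F}, (forall x, x - a x \in N) /\
    (forall x, x \in N -> a x \in smul (jacobson R) F).
Proof.
move=> slR projF; pose q := quotp (smul (jacobson R) F).
have [K' [NK'0 NK'top]] :=
  jacobson_kills_semisimple slR (@jacobson_kills_quot_smul R F) (lin_im q N).
pose K := lin_preim q K'.
have [x|a aP] := project_along (N := N) (K := K) projF.
  have [_ [z [/lin_imP [n Nn ->] Kz xE]]] := NK'top (q x).
  apply/sumP; exists n, (x - n); split=> //; last by rewrite addrC subrK.
  by apply/lin_preimP; rewrite linearB xE addrC addKr.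
exists a; split=> [x|x Nx]; first exact: (aP x).2.
apply/quotp_eq0; apply: NK'0; last by have [/lin_preimP] := aP x.
by apply: mem_lin_im; rewrite -[a x](subKr x); apply: submod_sub (aP x).2.
Qed.

(** The cover is the Fitting component [P] of [F] on which [c = 1 - a] is
    locally nilpotent. Modulo the inverse image [N] of [J M], [a] is the
    identity, so the other component lies in [N] and [P] maps onto [M / J M],
    hence onto [M]. On [N], [c] is the identity modulo [J F], so the part of
    [P] in [N] lies in [J F], and in [J P] as [P] is a direct summand. *)
Lemma nakayama_left_perfect :
  semilocal R -> radical_nakayama R -> left_perfect R.
Proof.
move=> slR TN M; have [h h_surj _] := free_cover M.
set F := free_module R M in h h_surj *.
have projF : projective F := @free_projective R M.
pose N := lin_preim h (smul (jacobson R) M).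
have [a [aN aJ]] := lift_complement N slR projF.
have c_lin : linear (fun x => x - a x).
  by move=> r x y; rewrite linearP opprD addrACA -scalerBr.
pose c := lin_of c_lin.
have cE x : c x = x - a x by [].
have ac1 x : a x + c x = x by rewrite cE addrC subrK.
have nil_ac := @radical_locally_nilpotent R F (a \o c : {linear F -> F}) TN
  (fun x => aJ _ (aN x)).
have ca_top : full_submod (submod_sum (nil_part c) (nil_part a)).
  move=> x; have /nil_partP [n nx] := nil_ac x.
  rewrite (iter_comp_comm ac1) in nx.
  have /sumP [y [z [y0 z1 ->]]] := fitting_sum ac1 nx.
  by apply/sumP; exists z, y; rewrite addrC.
have [p [pK _]] :=
  complement_projection (fun x x1 x0 => fitting_cap ac1 x0 x1) ca_top.
have nil_a_N x : x \in nil_part a -> x \in N.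
  move=> /nil_partP [n nx]; rewrite -[x]subr0 -nx.
  elim: n {nx} => [|n IHn]; first by rewrite subrr rpred0.
  have -> : x - iter n.+1 a x = (x - iter n a x) + c (iter n a x).
    by rewrite cE addrA subrK.
  by rewrite rpredD ?[c _ \in N]aN.
have nil_c_J x : x \in nil_part c -> x \in N -> x \in smul (jacobson R) F.
  move=> /nil_partP [n nx] Nx; rewrite -[x]subr0 -nx.
  have cnN m : iter m c x \in N by case: m => [//|m]; apply: aN.
  elim: n {nx} => [|n IHn]; first by rewrite subrr rpred0.
  have -> : x - iter n.+1 c x = (x - iter n c x) + a (iter n c x).
    by rewrite [iter n.+1 c x]cE opprB addrCA addrC.
  by rewrite rpredD ?aJ.
pose f : {linear sub_module (nil_part c) -> M} := h \o sub_incl (nil_part c).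
have f_full : full_submod (lin_im f (whole _)).
  apply: radical_superfluous TN _ => m; have [x <-] := h_surj m.
  have /sumP [z [y [z1 y0 ->]]] := ca_top x; rewrite linearD addrC; apply/sumP.
  exists (h y), (h z); split=> //; first by apply/lin_preimP/nil_a_N.
  by apply/lin_imP; exists (sub_elt z1); rewrite ?in_whole.
exists (sub_module (nil_part c)), f; split.
- exact: projective_retract pK projF.
- by move=> m; have /lin_imP [x _ ->] := f_full m; exists x.
move=> L top; apply: radical_superfluous TN _ => x.
have [y [z [fy Lz ->]]] := top x; apply/sumP; exists y, z; split=> //.
rewrite -[y]pK; apply: smul_lin; apply: nil_c_J; first exact: sub_inclP.
by apply/lin_preimP; rewrite -[h _]/(f y) fy rpred0.
Qed.

End Covers.

(** * Cotorsion classes of t-radicals *)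

Section Conatural.
Variable R : pzRingType.
Implicit Types (D : mod_class R) (M X Q : lmodType R) (I : submodClosed R^o).

Lemma torsion_quotient_closed (s : preradical R) :
  quotient_closed (torsion_class s).
Proof.
by move=> M Q f f_surj sM y; have [x <-] := f_surj y; apply: prerad_hom.
Qed.

Definition smul_preradical I : preradical R :=
  Preradical (prerad := smul I) (fun M Q f x => @smul_lin R I M Q f x).

(** The ideal [I R] of this preradical may be larger than [I], but
    [I R M = I M]. *)
Lemma smul_t_radical I : t_radical (smul_preradical I).
Proof.
move=> M x; split=> [/smulP|].
  move=> [n [a [m [Ia ->]]]]; exists n, a, m; split=> // i.
  rewrite -[a i]mulr1; exact: (@mem_smul R I R^o (a i) 1 (Ia i)).
move=> /smulP; apply: smul_sub => a m aI.
exact: (smul_lin (scale_map m) aI).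
Qed.

Lemma quot_perp_quotient D M Q (f : {linear M -> Q}) :
  surjective_lin f -> quot_perp D M -> quot_perp D Q.
Proof.
move=> f_surj DM Q' g g_surj; apply: (DM Q' (g \o f : {linear M -> Q'})) => y.
by have [z <-] := g_surj y; have [x <-] := f_surj z; exists x.
Qed.

Lemma id_surj M : surjective_lin (idfun : {linear M -> M}).
Proof. by move=> x; exists x. Qed.

(** The condition is evaluated at the class of modules killed by [J]; the
    corresponding ideal is shown to contain [1]. *)
Lemma conatural_nakayama :
  t_radical_cotorsion_class R = conatural_class R -> radical_nakayama R.
Proof.
move=> eqRC.
have qcJ : quotient_closed (@jacobson_kills R).
  by move=> M Q f; apply: jacobson_kills_quotient.
have : conatural_class R (quot_perp (@jacobson_kills R)).
  by exists (@jacobson_kills R).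
rewrite -eqRC => -[s s_t CE].
pose I := s R^o; pose L := submod_sum I (jacobson R).
have L1 : (1 : R) \in L.
  apply/quotp_eq0.
  have JX : jacobson_kills (quot_module L).
    move=> a x Ja; have [r <-] := quotp_surj x; rewrite -linearZ.
    by apply/quotp_eq0/sub_sumr; apply: jacobson_mulr.
  (* Right multiplications preserve [I], so [I] kills [R / L]. *)
  have : quot_perp (@jacobson_kills R) (quot_module L).
    rewrite CE => Q f f_surj sQ y; apply/zeroP.
    have /(s_t _ _)/smulP := sQ y; move: y; apply: smul_sub => a m Ia.
    apply/zeroP; have [x <-] := f_surj m; have [r <-] := quotp_surj x.
    rewrite -!linearZ; rewrite (quotp_eq0 L _).2 ?linear0 //.
    apply: sub_suml; exact: (prerad_hom (scale_map (r : R^o)) Ia).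
  by move=> /(_ _ _ (@id_surj _) JX); apply.
have I1 : (1 : R) \in I.
  have /sumP [i [j [Ii Jj ijE]]] := L1; have [u uE] := jacobson_left_inv Jj.
  suff -> : (1 : R) = u *: (i : R^o) by apply: (@rpredZ R R^o).
  by rewrite -[LHS]uE ijE; congr (u * _); apply: (@addrK R).
move=> M JM x.
have : quot_perp (@jacobson_kills R) M.
  move=> Q f f_surj JQ y; apply/zeroP; have [m <-] := f_surj y.
  move: (f m) (smul_lin f (JM m)); apply: smul_sub => a z Ja.
  by apply/zeroP/JQ.
rewrite CE => /(_ _ _ (@id_surj _)); apply=> m.
by apply/s_t/smulP; rewrite -[m]scale1r mem_smul.
Qed.

(** A complement of the kernel is carried isomorphically onto the quotient. *)
Lemma semisimple_section M Q (g : {linear M -> Q}) :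
  semisimple M -> surjective_lin g ->
  exists k : {linear Q -> M}, forall y, g (k y) = y.
Proof.
move=> ssM g_surj; pose N := lin_preim g (zero_submod Q).
have [K [NK0 top]] := ssM N.
have KNtop : full_submod (submod_sum K N).
  move=> x; have [y [z [Ny Kz ->]]] := top x.
  by apply/sumP; exists z, y; rewrite addrC.
have [p [_ pE]] := complement_projection (fun x Kx Nx => NK0 x Nx Kx) KNtop.
have gp x : g (sub_incl K (p x)) = g x.
  by have /lin_preimP/zeroP := pE x; rewrite linearB => /subr0_eq.
have [x gx0|k kE] :=
  factor_through (f := sub_incl K \o p : {linear M -> M}) g_surj.
  apply: NK0; last exact: sub_inclP.
  by apply/lin_preimP/zeroP; rewrite /= gp.
by exists k => y; have [x <-] := g_surj y; rewrite kE /= gp.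
Qed.

(** The image of [k] is a quotient of [M] and, being a summand, of [X]. *)
Lemma hom_quot_perp_eq0 D M X (k : {linear M -> X}) :
  quotient_closed D -> D M -> semisimple X -> quot_perp D X ->
  forall x, k x = 0.
Proof.
move=> qcD DM ssX DX x; pose W := lin_im k (whole M).
have kW y : k y \in W by apply: mem_lin_im; apply: in_whole.
have DW : D (sub_module W).
  apply: (qcD _ _ (corestrict kW)) => // w.
  have /lin_imP [y _ yE] := sub_inclP w.
  by exists y; apply: sub_incl_inj; rewrite yE.
have [K [WK0 top]] := ssX W.
have [|p [pK _]] := complement_projection WK0.
  by move=> y; apply/sumP/top.
have p_surj : surjective_lin p by move=> w; exists (sub_incl W w); rewrite pK.
have := DX _ _ p_surj DW (corestrict kW x) => /(congr1 (sub_incl W)).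
by rewrite linear0.
Qed.

Section Annihilator.
Variable D : mod_class R.
Hypotheses (slR : semilocal R) (qcD : quotient_closed D).

(** With [R] semilocal, the modules [X] below are the semisimple modules without
    nonzero quotient in [D]. *)
Fact perp_annihilator_axiom : @submod_axiom R R^o (fun a => forall X,
  quot_perp D X -> jacobson_kills X -> forall x : X, (a : R) *: x = 0).
Proof.
split=> [X _ _ x|a b c bI cI X DX JX x]; first exact: scale0r.
by rewrite scalerDl -scalerA bI // cI // scaler0 addr0.
Qed.

Definition perp_annihilator : submodClosed R^o :=
  submod_of perp_annihilator_axiom.

Lemma perp_annihilatorP (a : R) : a \in perp_annihilator <-> forall X,
  quot_perp D X -> jacobson_kills X -> forall x : X, a *: x = 0.
Proof. exact: (submod_ofP perp_annihilator_axiom a). Qed.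

(** A cyclic submodule [C] of [X] is a summand, hence in [D], and is a quotient
    of the semisimple module [R / I], where [I] is the annihilator; let [k] be a
    section.  The class of [r] in [R / I] is detected by the elements [r *: y]
    of the modules [Y] defining [I], but a map from [C] to [Y] is zero.  So [k],
    and with it [C], is zero. *)
Lemma perp_annihilator_zero X : D X -> jacobson_kills X ->
  (forall (a : R) (x : X), a \in perp_annihilator -> a *: x = 0) ->
  forall x : X, x = 0.
Proof.
move=> DX JX IX x; pose C := cyclic x; pose I := perp_annihilator.
have [K [CK0 top]] := jacobson_kills_semisimple slR JX C.
have [|p [pK _]] := complement_projection CK0.
  by move=> y; apply/sumP/top.
have p_surj : surjective_lin p by move=> w; exists (sub_incl C w); rewrite pK.
have DC : D (sub_module C) by apply: qcD p_surj DX.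
have JI : {subset jacobson R <= I}.
  by move=> a Ja; apply/perp_annihilatorP => Y _ JY y; exact: (JY a y Ja).
have ssRI : semisimple (quot_module I).
  apply: jacobson_kills_semisimple => // a y Ja; have [r <-] := quotp_surj y.
  by rewrite -linearZ; apply/quotp_eq0/JI; apply: jacobson_mulr.
pose f := corestrict (N := C) (f := scale_map x) (in_cyclic x).
have [a /quotp_eq0 Ia|g gE] := factor_through (f := f) (quotp_surj (N := I)).
  by apply: sub_incl_inj; rewrite linear0; apply: IX.
have g_surj : surjective_lin g.
  move=> w; have /cyclicP [a aE] := sub_inclP w.
  by exists (quotp I a); rewrite gE; apply: sub_incl_inj; rewrite aE.
have [k kE] := semisimple_section ssRI g_surj.
have k0 w : k w = 0.
  have [r rE] := quotp_surj (k w); rewrite -rE.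
  apply/quotp_eq0/perp_annihilatorP => Y DY JY y.
  have [a /quotp_eq0 /perp_annihilatorP aI|h hE] :=
    factor_through (f := scale_map y) (quotp_surj (N := I)); first exact: aI.
  have := hom_quot_perp_eq0 (h \o k : {linear sub_module C -> Y}) qcD DC
     (jacobson_kills_semisimple slR JY) DY w.
  by rewrite /= -rE hE.
have := kE (sub_elt (mem_cyclic x)); rewrite k0 linear0.
by move=> /(congr1 (sub_incl C)); rewrite linear0.
Qed.

(** Left to right, a quotient [Q] with [I Q = Q] has [Q / J Q] killed by [I],
    so [Q = J Q]. Right to left, for a quotient [Q] in [D] the module
    [X = Q / J Q] satisfies [I X = X], because [X / I X] is in [D] and killed
    by [I] and [J]; so [X] is zero. *)
Lemma quot_perp_cotorsion : radical_nakayama R ->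
  quot_perp D = cotorsion_class (smul_preradical perp_annihilator).
Proof.
move=> TN; set I := perp_annihilator; apply: funext => M; apply: propext; split.
  move=> DM Q f f_surj IQ; apply: TN => y; move: y (IQ y).
  apply: smul_sub => a m /perp_annihilatorP aI.
  apply/quotp_eq0; rewrite linearZ.
  apply: aI; last exact: jacobson_kills_quot_smul.
  apply: quot_perp_quotient (@quotp_surj _ _ _) _.
  exact: quot_perp_quotient f_surj DM.
move=> IM Q f f_surj DQ; apply: TN => y; apply/quotp_eq0.
pose X := quot_module (smul (jacobson R) Q).
have qf_surj : surjective_lin (quotp _ \o f : {linear M -> X}).
  move=> x; have [z <-] := @quotp_surj _ _ (smul (jacobson R) Q) x.
  by have [m <-] := f_surj z; exists m.
apply: (IM X _ qf_surj) => x; apply/quotp_eq0.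
apply: perp_annihilator_zero.
- exact: (qcD (@quotp_surj _ _ _) (qcD (@quotp_surj _ _ _) DQ)).
- apply: jacobson_kills_quotient (@quotp_surj _ _ _) _.
  exact: jacobson_kills_quot_smul.
- by move=> a z Ia; apply: smul_quot_eq0; apply: mem_smul.
Qed.

End Annihilator.

Lemma nakayama_conatural : semilocal R -> radical_nakayama R ->
  t_radical_cotorsion_class R = conatural_class R.
Proof.
move=> slR TN; apply: funext => C; apply: propext.
split=> [[s _ ->]|[D qcD ->]].
  by exists (torsion_class s) => //; apply: torsion_quotient_closed.
exists (smul_preradical (perp_annihilator D)); first exact: smul_t_radical.
exact: quot_perp_cotorsion.
Qed.

End Conatural.

Theorem corollary4p25 (R : pzRingType) (hR : semilocal R) :
  left_perfect R <->
  t_radical_cotorsion_class R = conatural_class R.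
Proof.
split=> [/left_perfect_nakayama|/conatural_nakayama].
  exact: nakayama_conatural.
exact: nakayama_left_perfect.
Qed.
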